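(* Let $\mathcal{X}$ be a finite set, let $\mathcal{B}$ be the set of probability distributions on $\mathcal{X}$ and $l(b,x)=\log\frac{1}{b(x)}$ (natural logarithm). For a sequence $x_1,x_2,\ldots\in\mathcal{X}$ let $N_t(x)$ be the number of $i\le t$ with $x_i=x$. Let $(h_t)_{t\ge1}$ be a non-decreasing positive sequence and $u_t(x)$ i.i.d. uniform on $[0,1]$. The FPF predictor is $\hat b_t=\arg\min_{b\in\mathcal{B}}\sum_xP^{(u)}_t(x)l(b,x)$ where $P^{(u)}_t(x)=\frac{N_{t-1}(x)+h_tu_t(x)}{t-1+h_t\sum_{x'}u_t(x')}$ (so $\hat b_t=P^{(u)}_t$). With $\hat L_n=\sum_{t=1}^nl(\hat b_t,x_t)$, $L_n^*=\min_{b\in\mathcal{B}}\sum_{t=1}^nl(b,x_t)$, and $\overline{\mathcal{R}}_{\max}=\max_{x_1^n\in\mathcal{X}^n}\mathbb{E}[\hat L_n-L_n^*]$: (1) $$\overline{\mathcal{R}}_{\max}\le\sum_{t=1}^n\frac{|\mathcal{X}|h_t-1}{t}+\sum_{t=1}^n\frac{1}{\lfloor\frac{t-1}{|\mathcal{X}|}\rfloor+h_t};$$ (2) for any $h_t=h_1t^{\alpha}$ with $h_1>0$ and $\alpha\in[0,1)$, $\frac1n\overline{\mathcal{R}}_{\max}\to0$ as $n\to\infty$; (3) for constant $h_t\equiv h$, $\overline{\mathcal{R}}_{\max}=O(\log n)$, and for $h=|\mathcal{X}|^{-1}$, $\overline{\mathcal{R}}_{\max}\le|\mathcal{X}|\log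 n$.
   Context: The expectation is over the random dither $u_t$.
   Formalization: The final bound R_max ≤ |X| log n for h = 1/|X| is proved only for all sufficiently large n (threshold depending on |X|); it fails for small n, e.g. n = 1 with |X| ≥ 2, where log n = 0 but the expected regret is positive. X is nonempty and b̂_t is taken directly as P_t^(u). *)

(* Defs.v *)
From HB Require Import structures.
From mathcomp Require Import all_boot all_order all_algebra.
From mathcomp Require Import all_classical all_reals all_analysis.
Set Implicit Arguments. Unset Strict Implicit. Unset Printing Implicit Defensive.
Import Order.TTheory GRing.Theory Num.Theory.
Local Open Scope classical_set_scope.
Local Open Scope ring_scope.

Section FPF.
Variables (R : realType) (T : finType).

Definition logloss (b : T -> R) (y : T) : \bar R :=
  if 0 < b y then (- ln (b y))%:E else +oo%E.

Definition is_distr (b : T -> R) : Prop :=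
  (forall y, 0 <= b y) /\ \sum_(y : T) b y = 1.

(* N_t(y) = #{ 1 <= i <= t | x_i = y }  (the sequence is x 1, x 2, ...) *)
Definition Ncount (x : nat -> T) (t : nat) (y : T) : nat :=
  \sum_(1 <= i < t.+1) (x i == y).

Definition Pu (x : nat -> T) (h : nat -> R) (t : nat) (u : T -> R) : T -> R :=
  fun y => ((Ncount x t.-1 y)%:R + h t * u y) /
           ((t.-1)%:R + h t * \sum_(y' : T) u y').

Definition fpf := Pu.

Fixpoint iter_unif (s : seq T) (f : (T -> R) -> \bar R) (u : T -> R) : \bar R :=
  match s with
  | [::] => f u
  | y :: s' => (\int[@lebesgue_measure R]_(v in `[0%R, 1%R]) 
                  iter_unif s' f (fun z => if z == y then v else u z))%E
  end.

(* expectation over the dither u = (u(y))_{y in T}, i.i.d. uniform on [0,1] *)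
Definition Eu (f : (T -> R) -> \bar R) : \bar R := iter_unif (enum T) f (fun _ => 0).

(* E[ hat L_n ] = sum_{t=1}^n E[ l(bhat_t, x_t) ]   (u_t only enters round t) *)
Definition ExpLhat (x : nat -> T) (h : nat -> R) (n : nat) : \bar R :=
  (\sum_(1 <= t < n.+1) Eu (fun u => logloss (fpf x h t u) (x t)))%E.

Definition Lstar (x : nat -> T) (n : nat) : \bar R :=
  ereal_inf [set (\sum_(1 <= t < n.+1) logloss b (x t))%E | b in [set b | is_distr b]].

Definition exp_regret (x : nat -> T) (h : nat -> R) (n : nat) : \bar R :=
  (ExpLhat x h n - Lstar x n)%E.

(* bar R_max = max over x_1^n of the expected regret (only x_1..x_n matter) *)
Definition Rmax (h : nat -> R) (n : nat) : \bar R :=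
  ereal_sup (range (fun x : nat -> T => exp_regret x h n)).

End FPF.

(* Main.v *)
Require Import Defs.
From HB Require Import structures.
From mathcomp Require Import all_boot all_order all_algebra.
From mathcomp Require Import all_classical all_reals all_analysis.
From mathcomp Require Import measurable_realfun ring lra.
Set Implicit Arguments. Unset Strict Implicit. Unset Printing Implicit Defensive.
Import Order.TTheory GRing.Theory Num.Theory.
Import numFieldNormedType.Exports.
Local Open Scope classical_set_scope.
Local Open Scope ring_scope.

(** Be-the-leader bounds the comparator loss below by the sum of
    [ln (t / N_t(x_t))], so round [t] contributes at most
    [ln ((t - 1 + m h_t) / t) + E ln ((N + 1) / (N + h_t u))], where [m = #|T|] and
    [N = N_{t-1}(x_t)].  The last expectation is a one-dimensional integral, bounded by
    [round_bound N h_t <= 1 / (N + h_t)].  A layer-cake argument shows that a balanced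
    sequence is the worst one, which gives (1), and with it (2) (Cesaro means) and (3).
    For [h = 1/m] the bound (1) overshoots [m ln n] by a constant; the claim holds for
    large [n] because [round_bound k h <= (1 - h/4) / k] lowers the coefficient of
    [ln n] by 1/4.  Constant sequences give [Rmax >= 0]. *)

(** * Monotonicity of the integral and elementary logarithm bounds *)

(** Positive and negative parts are each integrated as a supremum over simple functions below them,
    so monotonicity is inclusion of the index sets. This lets the iterated integrals in [Eu] be
    compared without a measurability proof. *)
Lemma integral_le_nomeas d (T : measurableType d) (R : realType)
    (mu : set T -> \bar R) (D : set T) (f g : T -> \bar R) :
  (forall x, D x -> (f x <= g x)%E) ->
  (\int[mu]_(x in D) f x <= \int[mu]_(x in D) g x)%E.
Proof.
move=> fg; have fgD x : ((f \_ D) x <= (g \_ D) x)%E.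
  by rewrite /patch; case: ifPn => // /set_mem /fg.
rewrite /integral; apply: leeB; apply: ereal_sup_le => _ [s /= sle <-];
  exists s => //= x; apply: le_trans (sle x) _.
- by rewrite !funeposE; exact: le_max2.
- by rewrite !funenegE; apply: le_max2 => //; rewrite leeN2.
Qed.

Lemma ln_leB1 (R : realType) (x : R) : 0 < x -> ln x <= x - 1.
Proof. by move=> x0; rewrite -{1}(subrK 1 x) addrC le_ln1Dx//; lra. Qed.

Lemma ln_geBV (R : realType) (x : R) : 0 < x -> 1 - x^-1 <= ln x.
Proof.
move=> x0; have := @ln_leB1 R x^-1; rewrite invr_gt0 => /(_ x0).
by rewrite lnV ?posrE//; lra.
Qed.

Lemma ln_ratio_le (R : realType) (x y : R) : 0 < x -> 0 < y ->
  ln x - ln y <= (x - y) / y.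
Proof.
move=> x0 y0; rewrite -ln_div ?posrE//.
apply: le_trans (ln_leB1 (divr_gt0 x0 y0)) _.
by rewrite mulrBl divff ?gt_eqF.
Qed.

(** * The bound for a single round *)

(** The sum of [(1 - h) / (a + h)], the cost of replacing [ln (a + h)] by [ln (a + 1)], and of [(h /
    2) / (a + h) + (h / 2) / (2 * a + h)], left over by the lower bound on [ln (a + h) - ln a]. *)
Definition round_bound (R : realType) (a h : R) : R :=
  (1 - h / 2) / (a + h) + (h / 2) / (2 * a + h).

Lemma round_bound_le_inv (R : realType) (a h : R) : 0 <= a -> 0 < h ->
  round_bound a h <= (a + h)^-1.
Proof.
move=> a0 h0; rewrite /round_bound.
have : (2 * a + h)^-1 <= (a + h)^-1 by rewrite lef_pV2 ?posrE; lra.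
by move=> /(ler_wpM2l (ltW (divr_gt0 h0 (ltr0Sn _ 1)))); lra.
Qed.

Lemma round_bound0 (R : realType) (h : R) : 0 < h -> round_bound 0 h = h^-1.
Proof. by move=> h0; rewrite /round_bound; field; lra. Qed.

(** Dropping [h] from both denominators leaves [(1 - h / 2) / a + (h / 4) / a]; [h <= 1] keeps the
    first numerator nonnegative. *)
Lemma round_bound_le_invl (R : realType) (a h : R) : 0 < a -> 0 < h <= 1 ->
  round_bound a h <= (1 - h / 4) / a.
Proof.
move=> a0 /andP[h0 h1]; rewrite /round_bound.
have H1 : (1 - h / 2) / (a + h) <= (1 - h / 2) / a.
  by apply: ler_wpM2l; rewrite ?lef_pV2 ?posrE; lra.
have H2 : (h / 2) / (2 * a + h) <= (h / 2) / (2 * a).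
  by apply: ler_wpM2l; rewrite ?lef_pV2 ?posrE; lra.
apply: le_trans (lerD H1 H2) _; rewrite le_eqVlt; apply/orP; left; apply/eqP.
by field; lra.
Qed.

(** * The integral of the logarithm of an affine function *)

Lemma derive_xlnx (R : realType) (a h v : R) : h != 0 -> 0 < a + h * v ->
  is_derive v 1 (fun v => v + - (h^-1 * ((a + h * v) * ln (a + h * v))))
    (- ln (a + h * v)).
Proof.
move=> h0 av.
have dl : is_derive v 1 (fun v => a + h * v) h.
  by apply: is_derive_eq; rewrite /GRing.scale/=; ring.
have dln : is_derive v 1 (fun v => ln (a + h * v)) ((a + h * v)^-1 * h).
  have := is_derive1_ln av => dln.
  by have := @is_derive1_comp _ (@ln R) (fun v => a + h * v) v _ _ dln dl.
apply: is_derive_eq.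
rewrite /GRing.scale /=.
by field; rewrite h0 gt_eqF.
Qed.

Lemma continuous_ln_affine (R : realType) (a h v : R) : 0 < a + h * v ->
  {for v, continuous (fun v => ln (a + h * v))}.
Proof.
move=> av; apply: (@continuous_comp _ _ _ (fun v => a + h * v) (@ln R)).
  by apply: cvgD; [exact: cvg_cst | apply: cvgM; [exact: cvg_cst|exact: cvg_id]].
exact: continuous_ln.
Qed.

Lemma affine_gt0 (R : realType) (a h v : R) : 0 < a -> 0 < h -> 0 <= v ->
  0 < a + h * v.
Proof. by move=> a0 h0 v0; rewrite ltr_pwDl// mulr_ge0// ltW. Qed.

Lemma integral_ln_affine (R : realType) (a h c : R) : 0 < a -> 0 < h ->
  (\int[lebesgue_measure]_(v in `[0%R, 1%R]) (c - ln (a + h * v))%:E)%E =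
  (c + 1 - ((a + h) * ln (a + h) - a * ln a) / h)%:E.
Proof.
move=> a0 h0.
have hn0 : h != 0 by rewrite gt_eqF.
pose F (v : R) : R^o := c * v + (v + - (h^-1 * ((a + h * v) * ln (a + h * v)))).
have dF (v : R) : 0 <= v -> is_derive v 1 F (c - ln (a + h * v)).
  move=> v0; have av := affine_gt0 a0 h0 v0.
  have := derive_xlnx hn0 av => d2.
  by apply: is_derive_eq; rewrite /GRing.scale/=; ring.
have cF (v : R) : 0 <= v -> {for v, continuous F}.
  move=> v0; apply: differentiable_continuous; apply/derivable1_diffP.
  by have [] := dF v v0.
rewrite (@continuous_FTC2 _ _ F).
- rewrite -EFinB; congr EFin; rewrite /F !mulr0 !mulr1 !addr0 add0r.
  by field.
- exact: ltr01.
- apply: continuous_in_subspaceT => v; rewrite inE/= in_itv/= => /andP[v0 _].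
  apply: cvgB; first exact: cvg_cst.
  exact: continuous_ln_affine (affine_gt0 a0 h0 v0).
- split.
  + by move=> v; rewrite in_itv/= => /andP[/ltW/dF[]].
  + by apply: cvg_at_right_filter; apply: cF.
  + by apply: cvg_at_left_filter; apply: cF.
- move=> v; rewrite in_itv/= => /andP[/ltW/dF d _].
  by rewrite derive1E derive_val.
Qed.

(* The trapezoid-like refinement [ln (1 + y) >= (y/2) / (1 + y) + (y/2) / (1 + y/2)],
   with [y = h / a], is what makes the constant in front of [1 / a] smaller than [1]. *)
Lemma integral_ln_affine_le (R : realType) (a h c : R) : 0 < a -> 0 < h ->
  (\int[lebesgue_measure]_(v in `[0%R, 1%R]) (c - ln (a + h * v))%:E <=
  (c - ln (a + 1) + round_bound a h)%:E)%E.
Proof.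
move=> a0 h0; rewrite integral_ln_affine// lee_fin.
have ah : 0 < a + h by lra.
have H1 : ln (a + 1) - ln (a + h) <= (1 - h) / (a + h).
  by have := @ln_ratio_le _ (a + 1) (a + h); rewrite opprD addrACA subrr add0r; apply; lra.
(* Split [ln ((a + h) / a)] at the midpoint [a + h / 2] and apply [1 - 1 / x <= ln x] to both
   ratios. *)
have H2 : (h / 2) / (a + h) + (h / 2) / (a + h / 2) <= ln (a + h) - ln a.
  have a2 : 0 < a + h / 2 by lra.
  have := @ln_geBV _ _ (divr_gt0 ah a2); rewrite ln_div ?posrE// invf_div.
  have := @ln_geBV _ _ (divr_gt0 a2 a0); rewrite ln_div ?posrE// invf_div.
  have -> : 1 - a / (a + h / 2) = (h / 2) / (a + h / 2) by field; lra.
  have -> : 1 - (a + h / 2) / (a + h) = (h / 2) / (a + h) by field; lra.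
  by lra.
have -> : ((a + h) * ln (a + h) - a * ln a) / h =
   ln (a + h) + (a / h) * (ln (a + h) - ln a) by field; lra.
have := ler_wpM2l (ltW (divr_gt0 a0 h0)) H2.
have -> : a / h * (h / 2 / (a + h) + h / 2 / (a + h / 2)) =
  1 - (h / 2) / (a + h) - (h / 2) / (2 * a + h) by field; lra.
rewrite /round_bound; lra.
Qed.

(** * The case of an unseen symbol, by monotone convergence *)

Lemma cvg_addr_harmonic (R : realType) (c : R) :
  (fun n => c + harmonic n) @ \oo --> c.
Proof.
by rewrite -{2}(addr0 c); apply: cvgD; [exact: cvg_cst | exact: cvg_harmonic].
Qed.

Lemma cvg_ln_harmonic (R : realType) (c : R) : 0 < c ->
  (fun n => ln (c + harmonic n)) @ \oo --> ln c.
Proof.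
move=> c0; apply: (@cvg_comp _ _ _ (fun n => c + harmonic n) (@ln R) _ (nbhs c)).
  exact: cvg_addr_harmonic.
exact: continuous_ln.
Qed.

(** The integrand is infinite at [v = 0], so both logarithms are shifted by [harmonic n]. Since
    [h <= C], the shifted integrands are nonnegative and increase with [n]; the case [a > 0] bounds
    each integral, and the bounds pass to the limit. *)
Lemma integral_ln_at0_le (R : realType) (C h : R) : 0 < h -> h <= C ->
  (\int[lebesgue_measure]_(v in `[0%R, 1%R])
     (if (0 < h * v)%R then (ln C - ln (h * v))%:E else +oo) <=
  (ln C + h^-1)%:E)%E.
Proof.
move=> h0 hC; have C0 : 0 < C by lra.
have e0 n : 0 < (harmonic n : R) by exact: harmonic_gt0.
pose f n (v : R) := (ln (C + harmonic n) - ln (harmonic n + h * v))%:E.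
have mono v : v \in `[0, 1] -> {homo f^~ v : n m / (n <= m)%N >-> (n <= m)%E}.
  rewrite in_itv/= => /andP[v0 v1] n m nm; rewrite lee_fin.
  have w0 : 0 <= h * v by rewrite mulr_ge0// ltW.
  have wC : h * v <= C by apply: le_trans hC; rewrite ler_piMr// ltW.
  have em : (harmonic m : R) <= harmonic n by rewrite /= lef_pV2 ?posrE// ler_nat.
  have := e0 n; have := e0 m; move: (harmonic m) (harmonic n) em => e' e em e'0 e1.
  rewrite -!ln_div ?posrE; try lra.
  rewrite ler_ln ?posrE ?divr_gt0//; try lra.
  rewrite ler_pdivrMr; last lra.
  rewrite mulrAC ler_pdivlMr; last lra.
  nra.
have fge0 n v : v \in `[0, 1] -> (0 <= f n v)%E.
  rewrite /= in_itv/= => /andP[v0 v1]; rewrite lee_fin subr_ge0.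
  have w0 : 0 <= h * v by rewrite mulr_ge0// ltW.
  have wC : h * v <= C by apply: le_trans hC; rewrite ler_piMr// ltW.
  have := e0 n; move: (harmonic n) => e e1.
  by rewrite ler_ln ?posrE; lra.
have mf n : measurable_fun (`[0%R, 1%R]%classic : set R) (f n).
  apply/measurable_EFinP; apply: subspace_continuous_measurable_fun => //.
  apply: continuous_in_subspaceT => v; rewrite inE/= in_itv/= => /andP[v0 _].
  apply: cvgB; first exact: cvg_cst.
  exact: continuous_ln_affine (affine_gt0 (e0 n) h0 v0).
have mcv := @cvg_monotone_convergence _ _ _ (@lebesgue_measure R) (`[0%R, 1%R]%classic : set R)
  (measurable_itv _) f mf fge0 mono.
apply: (@le_trans _ _ (\int[lebesgue_measure]_(v in `[0%R, 1%R]) limn (f^~ v))%E).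
  apply: integral_le_nomeas => v v01; rewrite le_eqVlt; apply/orP; left; apply/eqP.
  apply/esym/cvg_lim => //; case: ifPn => hv.
    apply: cvg_EFin; first exact: nearW.
    apply: cvgB; first exact: cvg_ln_harmonic.
    under eq_fun do rewrite addrC.
    exact: cvg_ln_harmonic.
  have -> : v = 0.
    move: v01 hv; rewrite /= in_itv/= => /andP[v0 _]; rewrite pmulr_rgt0// -leNgt.
    by move=> v0'; apply/eqP; rewrite eq_le v0 v0'.
  (* At [v = 0] the limit is [+oo]: [ln C - ln e >= A] once [e <= C * expR (- A)]. *)
  apply/cvgeyPge => A.
  have : \forall n \near \oo, (harmonic n : R) < C * expR (- A).
    by apply: (cvgr_lt 0); [exact: cvg_harmonic | rewrite mulr_gt0// expR_gt0].
  apply: filterS => n /ltW.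
  rewrite -ler_ln ?posrE ?mulr_gt0 ?expR_gt0// lnM ?posrE ?expR_gt0// expRK => H.
  have H2 : ln C <= ln (C + harmonic n).
    by rewrite ler_ln ?posrE ?ltr_wpDr// ?lerDl// ltW.
  by rewrite lee_fin mulr0 addr0; lra.
(* The term [harmonic n / C] pays for [ln (C + harmonic n) - ln C]. *)
have bcv : (fun n => (ln C + harmonic n / C + h^-1)%:E) @ \oo --> (ln C + h^-1)%:E.
  apply: cvg_EFin; first exact: nearW.
  apply: cvgD; last exact: cvg_cst.
  rewrite -[X in _ --> X]addr0; apply: cvgD; first exact: cvg_cst.
  by rewrite -[X in _ --> X](mul0r C^-1); apply: cvgM; [exact: cvg_harmonic|exact: cvg_cst].
rewrite -(cvg_lim _ mcv)// -(cvg_lim _ bcv)//.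
apply: lee_lim; [by apply/cvg_ex; eexists; exact: mcv|by apply/cvg_ex; eexists; exact: bcv|].
apply: nearW => n; rewrite /f.
apply: le_trans (@integral_ln_affine_le _ _ _ _ (e0 n) h0) _; rewrite lee_fin.
have := e0 n; move: (harmonic n) => e e1.
have := round_bound_le_inv (ltW e1) h0.
have : (e + h)^-1 <= h^-1 by rewrite lef_pV2 ?posrE; lra.
have : 0 <= ln (e + 1) by rewrite ln_ge0//; lra.
have := @ln_ratio_le _ (C + e) C; rewrite addrAC subrr add0r => /(_ _ C0).
have -> : 0 < C + e by lra.
by move=> /(_ isT); lra.
Qed.

Lemma integral_ln_affine_le_gen (R : realType) (C a h : R) :
  0 <= a -> 0 < h -> a + h <= C ->
  (\int[lebesgue_measure]_(v in `[0%R, 1%R])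
     (if (0 < a + h * v)%R then (ln C - ln (a + h * v))%:E else +oo) <=
  (ln C - ln (a + 1) + round_bound a h)%:E)%E.
Proof.
rewrite le_eqVlt => /predU1P[<-|a0] h0 aC.
  rewrite add0r ln1 subr0 round_bound0//.
  under eq_integral do rewrite add0r.
  by apply: integral_ln_at0_le => //; rewrite add0r in aC.
apply: le_trans (integral_ln_affine_le _ a0 h0).
apply: integral_le_nomeas => v; rewrite /= in_itv/= => /andP[v0 v1].
by rewrite affine_gt0.
Qed.

(** * Expectation over the dither *)

Lemma iter_unif_le (R : realType) (T : finType) (s : seq T)
    (f g : (T -> R) -> \bar R) (u : T -> R) :
  (forall u, (forall y, 0 <= u y <= 1) -> (f u <= g u)%E) ->
  (forall y, 0 <= u y <= 1) -> (iter_unif s f u <= iter_unif s g u)%E.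
Proof.
move=> fg; elim: s u => [|y s IH] u u01 /=; first exact: fg.
apply: integral_le_nomeas => v; rewrite /= in_itv/= => v01.
by apply: IH => z; case: ifP.
Qed.

Lemma Eu_le (R : realType) (T : finType) (f g : (T -> R) -> \bar R) :
  (forall u, (forall y, 0 <= u y <= 1) -> (f u <= g u)%E) -> (Eu f <= Eu g)%E.
Proof. by move=> fg; apply: iter_unif_le => // y; rewrite lexx ler01. Qed.

Lemma integral_cst01 (R : realType) (c : \bar R) :
  (\int[lebesgue_measure]_(v in `[0%R, 1%R]) c)%E = c.
Proof.
have := @integral_cst _ _ _ (@lebesgue_measure R) _ (measurable_itv `[0%R, 1%R]) c.
rewrite /= => ->; rewrite lebesgue_measure_itv/= lte_fin ltr01.
by rewrite oppr0 adde0 mule1.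
Qed.

(** A coordinate other than [y] integrates a constant over an interval of length 1. If [y] recurs in
    the tail, the inner integral overwrites the outer value, so the outer integrand is again
    constant. *)
Lemma iter_unif_coord (R : realType) (T : finType) (s : seq T) (g : R -> \bar R)
    (y : T) (u : T -> R) :
  iter_unif s (fun u => g (u y)) u =
  if y \in s then (\int[lebesgue_measure]_(v in `[0%R, 1%R]) g v)%E else g (u y).
Proof.
elim: s u => [//|z s IH] u /=; rewrite in_cons.
under eq_integral do rewrite IH.
case: (y \in s); rewrite ?orbT ?orbF; first exact: integral_cst01.
by case: (y == z) => //; exact: integral_cst01.
Qed.

Lemma Eu_coord (R : realType) (T : finType) (g : R -> \bar R) (y : T) :
  Eu (fun u => g (u y)) = (\int[lebesgue_measure]_(v in `[0%R, 1%R]) g v)%E.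
Proof. by rewrite /Eu iter_unif_coord mem_enum. Qed.

Lemma Eu_ge0 (R : realType) (T : finType) (f : (T -> R) -> \bar R) :
  (forall u, (forall y, 0 <= u y <= 1) -> (0 <= f u)%E) -> (0 <= Eu f)%E.
Proof.
move=> f0; apply: (@le_trans _ _ (Eu (fun _ : T -> R => 0)%E)); last exact: Eu_le.
have z0 (s : seq T) (u : T -> R) : (0 <= iter_unif s (fun=> 0) u)%E.
  by elim: s u => [|y s IH] u //=; apply: integral_ge0 => v _; exact: IH.
exact: z0.
Qed.

(** * Symbol counts *)

Lemma Ncount0 (T : finType) (x : nat -> T) (y : T) : Ncount x 0 y = 0%N.
Proof. by rewrite /Ncount big_geq. Qed.

Lemma NcountS (T : finType) (x : nat -> T) (t : nat) (y : T) :
  Ncount x t.+1 y = (Ncount x t y + (x t.+1 == y))%N.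
Proof. by rewrite /Ncount big_nat_recr. Qed.

Lemma Ncount_le (T : finType) (x : nat -> T) (t : nat) (y : T) :
  (Ncount x t y <= t)%N.
Proof.
elim: t => [|t IH]; first by rewrite Ncount0.
by rewrite NcountS -addn1 leq_add// leq_b1.
Qed.

Lemma Ncount_mono (T : finType) (x : nat -> T) (s t : nat) (y : T) :
  (s <= t)%N -> (Ncount x s y <= Ncount x t y)%N.
Proof.
move=> /subnK <-; elim: (t - s)%N => [|k IH] //.
by rewrite addSn NcountS (leq_trans IH)// leq_addr.
Qed.

Lemma Ncount_self (T : finType) (x : nat -> T) (t : nat) : (0 < t)%N ->
  Ncount x t (x t) = (Ncount x t.-1 (x t)).+1.
Proof. by case: t => // t _; rewrite NcountS eqxx addn1. Qed.

Lemma Ncount_gt0 (T : finType) (x : nat -> T) (t n : nat) : (0 < t <= n)%N ->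
  (0 < Ncount x n (x t))%N.
Proof.
move=> /andP[t0 tn]; apply: leq_trans (Ncount_mono x (x t) tn).
by rewrite Ncount_self.
Qed.

Lemma sum_Ncount (V : nmodType) (T : finType) (x : nat -> T) (F : T -> V) n :
  \sum_(1 <= t < n.+1) F (x t) = \sum_y F y *+ Ncount x n y.
Proof.
elim: n => [|n IH].
  by rewrite big_geq// big1// => y _; rewrite Ncount0.
rewrite big_nat_recr//= IH.
under [in RHS]eq_bigr do rewrite NcountS mulrnDr.
rewrite big_split/=; congr (_ + _).
rewrite (bigD1 (x n.+1))//= eqxx big1 ?addr0// => y.
by rewrite eq_sym => /negPf ->.
Qed.

(* The value [k] is taken by [Ncount x t.-1 (x t)] once for each symbol that
   occurs more than [k] times. *)
Lemma sum_prev_count (V : nmodType) (T : finType) (x : nat -> T) (F : nat -> V) n :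
  \sum_(1 <= t < n.+1) F (Ncount x t.-1 (x t)) =
  \sum_y \sum_(0 <= k < Ncount x n y) F k.
Proof.
elim: n => [|n IH].
  by rewrite big_geq// big1// => y _; rewrite Ncount0 big_geq.
rewrite big_nat_recr//= IH (bigD1 (x n.+1))//= [in RHS](bigD1 (x n.+1))//=.
rewrite NcountS eqxx addn1 big_nat_recr//= addrAC; congr (_ + _).
by apply: eq_bigr => y; rewrite eq_sym NcountS => /negPf ->; rewrite addn0.
Qed.

Lemma sum_nat_Ncount (T : finType) (x : nat -> T) n :
  (\sum_y Ncount x n y)%N = n.
Proof.
have := @sum_Ncount nat T x (fun=> 1%N) n.
rewrite sum_nat_const_nat muln1 subn1/= => {2}->.
by apply: eq_bigr => y _; rewrite -mulr_natr mul1r natn.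
Qed.

(** * Expected loss of one round *)

Section FPFRound.
Variables (R : realType) (T : finType) (x : nat -> T) (h : nat -> R) (t : nat).
Hypothesis h_gt0 : 0 < h t.

Lemma Pu_num_le_den (u : T -> R) (y : T) : (forall y, 0 <= u y <= 1) ->
  (Ncount x t.-1 y)%:R + h t * u y <= (t.-1)%:R + h t * \sum_z u z.
Proof.
move=> u01; apply: lerD; first by rewrite ler_nat Ncount_le.
rewrite ler_pM2l// (bigD1 y)//= lerDl sumr_ge0// => z _.
by have /andP[] := u01 z.
Qed.

Lemma Pu_num_ge0 (u : T -> R) (y : T) : (forall y, 0 <= u y <= 1) ->
  0 <= (Ncount x t.-1 y)%:R + h t * u y.
Proof.
by move=> u01; rewrite addr_ge0// mulr_ge0 ?(ltW h_gt0)//; have /andP[] := u01 y.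
Qed.

Lemma logloss_fpf_ge0 (u : T -> R) (y : T) : (forall y, 0 <= u y <= 1) ->
  (0 <= logloss (fpf x h t u) y)%E.
Proof.
move=> u01; rewrite /logloss; case: ifPn => // _; rewrite lee_fin oppr_ge0.
have := Pu_num_ge0 y u01; have := Pu_num_le_den y u01; rewrite /fpf/Pu => nd n0.
apply: ln_le0; have := le_trans n0 nd.
(* If the denominator is [0], the quotient is [0] by convention. *)
rewrite le_eqVlt => /predU1P[<-|d0]; first by rewrite invr0 mulr0 ler01.
by rewrite ler_pdivrMr// mul1r.
Qed.

(** Replacing the denominator by its largest value, reached when every [u z] is 1, leaves a function
    of [u y] alone, so that [Eu_coord] gives a one-dimensional integral. *)
Lemma logloss_fpf_le (u : T -> R) (y : T) : (forall y, 0 <= u y <= 1) ->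
  (logloss (fpf x h t u) y <=
   if (0 < (Ncount x t.-1 y)%:R + h t * u y)%R
   then (ln ((t.-1)%:R + #|T|%:R * h t) - ln ((Ncount x t.-1 y)%:R + h t * u y))%:E
   else +oo)%E.
Proof.
move=> u01; case: ifPn => [n0|_]; last exact: leey.
have := Pu_num_le_den y u01; rewrite /logloss /fpf/Pu => nd.
have d0 := lt_le_trans n0 nd.
rewrite divr_gt0// lee_fin ln_div ?posrE// opprB lerD2r ler_ln ?posrE//.
  rewrite lerD2l mulrC ler_pM2r// -sum1_card natr_sum; apply: ler_sum => z _.
  by have /andP[] := u01 z.
apply: lt_le_trans d0 _.
rewrite lerD2l mulrC ler_pM2r// -sum1_card natr_sum; apply: ler_sum => z _.
by have /andP[] := u01 z.
Qed.

Lemma Eu_logloss_le (y : T) :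
  (Eu (fun u => logloss (fpf x h t u) y) <=
   (ln ((t.-1)%:R + #|T|%:R * h t) - ln (Ncount x t.-1 y).+1%:R
    + round_bound (Ncount x t.-1 y)%:R (h t))%:E)%E.
Proof.
apply: le_trans (Eu_le (fun u => @logloss_fpf_le u y)) _.
rewrite (Eu_coord (fun v => if (0 < (Ncount x t.-1 y)%:R + h t * v)%R
   then (ln ((t.-1)%:R + #|T|%:R * h t) - ln ((Ncount x t.-1 y)%:R + h t * v))%:E
   else +oo)%E).
rewrite -natr1; apply: integral_ln_affine_le_gen => //.
apply: lerD; first by rewrite ler_nat Ncount_le.
by rewrite ler_peMl ?(ltW h_gt0)// ler1n; apply/card_gt0P; exists y.
Qed.

End FPFRound.

(** * Lower bound on the comparator and the regret of a fixed sequence *)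

(** Apply [ln z <= z - 1] to [z = b (x t) * n / Ncount x n (x t)]. Grouped by symbol, each occurring
    [y] contributes [b y * n], so the sum of the [z] is at most [n]. *)
Lemma gibbs_Ncount (R : realType) (T : finType) (x : nat -> T) (b : T -> R) n :
  is_distr b -> (forall t, (0 < t <= n)%N -> 0 < b (x t)) ->
  \sum_(1 <= t < n.+1) (ln n%:R - ln (Ncount x n (x t))%:R) <=
  \sum_(1 <= t < n.+1) - ln (b (x t)).
Proof.
move=> [b0 b1] bx; rewrite -subr_ge0 -sumrB -oppr_le0 -sumrN.
apply: (@le_trans _ _ (\sum_(1 <= t < n.+1)
    (b (x t) * n%:R / (Ncount x n (x t))%:R - 1))).
  apply: ler_sum_nat => t tn.
  have n0 : 0 < n%:R :> R by rewrite ltr0n; case/andP: tn => /leq_trans; exact.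
  have N0 : 0 < (Ncount x n (x t))%:R :> R by rewrite ltr0n Ncount_gt0.
  have := @ln_leB1 _ _ (divr_gt0 (mulr_gt0 (bx _ tn) n0) N0).
  by rewrite ln_div ?lnM ?posrE ?mulr_gt0// ?bx//; lra.
rewrite sumrB big_const_nat iter_addr addr0 subSS subn0 subr_le0.
rewrite (sum_Ncount x (fun y => b y * n%:R / (Ncount x n y)%:R)).
apply: (@le_trans _ _ (\sum_y b y * n%:R)); last by rewrite -mulr_suml b1 mul1r.
apply: ler_sum => y _; rewrite -[_ *+ Ncount _ _ _]mulr_natr.
have [->|N0] := eqVneq (Ncount x n y) 0%N; first by rewrite mulr0 mulr_ge0.
by rewrite divfK// pnatr_eq0.
Qed.

(* Be-the-leader: after Gibbs' inequality the last round is split off and the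
   induction hypothesis is applied to the empirical distribution itself. *)
Lemma leader_Ncount (R : realType) (T : finType) (x : nat -> T) (b : T -> R) n :
  is_distr b -> (forall t, (0 < t <= n)%N -> 0 < b (x t)) ->
  \sum_(1 <= t < n.+1) (ln t%:R - ln (Ncount x t (x t))%:R) <=
  \sum_(1 <= t < n.+1) - ln (b (x t)).
Proof.
elim: n b => [|n IH] b db bx; first by rewrite !big_geq.
apply: le_trans (gibbs_Ncount db bx).
rewrite big_nat_recr//= [leRHS]big_nat_recr//= lerD2r.
pose q y : R := (Ncount x n.+1 y)%:R / n.+1%:R.
have n0 : 0 < n.+1%:R :> R by rewrite ltr0n.
have Nx t : (0 < t <= n)%N -> 0 < (Ncount x n.+1 (x t))%:R :> R.
  by move=> /andP[t0 tn]; rewrite ltr0n Ncount_gt0// t0 leqW.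
have dq : is_distr q.
  split=> [y|]; first by rewrite divr_ge0.
  by rewrite -mulr_suml -natr_sum sum_nat_Ncount divff// gt_eqF.
have qx t : (0 < t <= n)%N -> 0 < q (x t) by move=> tn; rewrite divr_gt0// Nx.
apply: le_trans (IH q dq qx) _; apply: ler_sum_nat => t tn.
by rewrite ln_div ?posrE ?Nx// opprB.
Qed.

Lemma logloss_ge0 (R : realType) (T : finType) (b : T -> R) (y : T) :
  is_distr b -> (0 <= logloss b y)%E.
Proof.
move=> [b0 b1]; rewrite /logloss; case: ifPn => // _.
rewrite lee_fin oppr_ge0 ln_le0// -b1 (bigD1 y)//= lerDl.
by rewrite sumr_ge0.
Qed.

(** A competitor giving some observed symbol probability 0 has infinite loss; [leader_Ncount]
    handles the others. *)
Lemma Lstar_ge (R : realType) (T : finType) (x : nat -> T) n :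
  ((\sum_(1 <= t < n.+1) (ln t%:R - ln (Ncount x t (x t))%:R))%:E <=
   @Lstar R T x n)%E.
Proof.
apply/ereal_infP => _ [b /= db <-].
have [bx|] := pselect (forall t, (0 < t <= n)%N -> 0 < b (x t)).
  rewrite (eq_big_nat _ _ (F2 := fun t => (- ln (b (x t)))%:E)).
    by rewrite sumEFin lee_fin leader_Ncount.
  by move=> t tn; rewrite /logloss bx.
move=> /existsNP[t /not_implyP[tn /negP bt]].
rewrite [leRHS](bigD1_seq t) ?mem_index_iota ?iota_uniq//=.
have -> : logloss b (x t) = +oo%E by rewrite /logloss (negPf bt).
rewrite addye ?leey// gt_eqF// (@lt_le_trans _ _ 0%E)//.
by apply: sume_ge0 => *; exact: logloss_ge0.
Qed.

(** By [Ncount_self], the comparator's [ln (Ncount x t (x t))] cancels the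
    [ln (Ncount x t.-1 (x t)).+1] of the expected loss, round by round. *)
Lemma exp_regret_le (R : realType) (T : finType) (x : nat -> T) (h : nat -> R) n :
  (forall t, (1 <= t)%N -> 0 < h t) ->
  (exp_regret x h n <=
   (\sum_(1 <= t < n.+1) (ln ((t.-1)%:R + #|T|%:R * h t) - ln t%:R)
    + \sum_(1 <= t < n.+1) round_bound (Ncount x t.-1 (x t))%:R (h t))%:E)%E.
Proof.
move=> h0.
have Lhat_le : (ExpLhat x h n <= \sum_(1 <= t < n.+1)
    (ln ((t.-1)%:R + #|T|%:R * h t) - ln (Ncount x t.-1 (x t)).+1%:R
     + round_bound (Ncount x t.-1 (x t))%:R (h t))%:E)%E.
  rewrite /ExpLhat big_nat [leRHS]big_nat; apply: lee_sum => t /andP[t0 _].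
  exact: Eu_logloss_le (h0 t t0) (x t).
apply: le_trans (leeB Lhat_le (Lstar_ge R x n)) _.
rewrite sumEFin -EFinB lee_fin -sumrB -big_split/=.
rewrite le_eqVlt; apply/orP; left; apply/eqP; apply: eq_big_nat => t /andP[t0 _].
by rewrite Ncount_self//; ring.
Qed.

(** * Balanced sequences are the worst *)

Lemma sum_bool_le (P : pred nat) n : (\sum_(1 <= t < n.+1) P t <= n)%N.
Proof.
apply: (@leq_trans (\sum_(1 <= t < n.+1) 1)%N).
  by apply: leq_sum => t _; exact: leq_b1.
by rewrite sum_nat_const_nat muln1 subn1.
Qed.

(** The [j]-th selected round has index at least [j], hence weight at most [w j]. *)
Lemma sum_pred_le_initial (R : realType) (w : nat -> R) (P : pred nat) n :
  (forall i j, (0 < i <= j)%N -> w j <= w i) ->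
  \sum_(1 <= t < n.+1) (P t)%:R * w t <=
  \sum_(1 <= t < (\sum_(1 <= t < n.+1) P t)%N.+1) w t.
Proof.
move=> wmono; elim: n => [|n IH]; first by rewrite !big_geq.
have -> : (\sum_(1 <= t < n.+2) P t = \sum_(1 <= t < n.+1) P t + P n.+1)%N.
  by rewrite big_nat_recr.
rewrite big_nat_recr//=.
case: (P n.+1); last by rewrite addn0 mul0r addr0.
rewrite addn1 mul1r [leRHS]big_nat_recr//= lerD//.
by apply: wmono; exact: sum_bool_le.
Qed.

Lemma sum_pred_le_count (R : realType) (w : nat -> R) (P : pred nat) n M :
  (forall t, (0 < t)%N -> 0 <= w t) ->
  (forall i j, (0 < i <= j)%N -> w j <= w i) ->
  (\sum_(1 <= t < n.+1) P t <= M)%N ->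
  \sum_(1 <= t < n.+1) (P t)%:R * w t <=
  \sum_(1 <= t < n.+1) (t <= M)%N%:R * w t.
Proof.
move=> w0 wmono; have := @sum_pred_le_initial _ w P n wmono.
have := sum_bool_le P n.
move: (\sum_(1 <= t < n.+1) P t)%N => c cn /le_trans H cM; apply: H.
rewrite [leRHS](big_cat_nat (n := c.+1))//= -[leLHS]addr0; apply: lerD.
  apply: ler_sum_nat => t /andP[t0 tc].
  by rewrite (leq_trans _ cM)// mul1r.
rewrite big_nat sumr_ge0// => t /andP[ct _].
by rewrite mulr_ge0// w0// (leq_trans _ ct).
Qed.

(** The weight of layer [k] of [a |-> (a + h)^-1]: a difference, so that it telescopes, and
    nonincreasing in [h] by its product form [inv_stepE]. *)
Definition inv_step (R : realType) (k : nat) (h : R) : R :=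
  (k%:R + h)^-1 - (k.+1%:R + h)^-1.

Lemma inv_stepE (R : realType) (k : nat) (h : R) : 0 < h ->
  inv_step k h = ((k%:R + h) * (k.+1%:R + h))^-1.
Proof.
move=> h0; have k0 : 0 <= k%:R :> R by [].
by rewrite /inv_step -natr1; field; lra.
Qed.

Lemma inv_step_ge0 (R : realType) (k : nat) (h : R) : 0 < h -> 0 <= inv_step k h.
Proof.
move=> h0; rewrite inv_stepE// invr_ge0.
by rewrite mulr_ge0// addr_ge0// ltW.
Qed.

Lemma inv_step_le (R : realType) (k : nat) (h h' : R) : 0 < h -> h <= h' ->
  inv_step k h' <= inv_step k h.
Proof.
move=> h0 hh'; have h'0 := lt_le_trans h0 hh'.
have k0 : 0 <= k%:R :> R by [].
have k1 : 0 <= k.+1%:R :> R by [].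
rewrite !inv_stepE// lef_pV2 ?posrE ?mulr_gt0//; try lra.
by apply: ler_pM; lra.
Qed.

(** The layers [a <= k < K] telescope. A cap [K] common to all rounds allows the sums over rounds
    and layers to be exchanged. *)
Lemma inv_layer (R : realType) (a K : nat) (h : R) : (a <= K)%N ->
  (a%:R + h)^-1 = (K%:R + h)^-1 + \sum_(0 <= k < K) (a <= k)%N%:R * inv_step k h.
Proof.
elim: K => [|K IH]; first by rewrite leqn0 => /eqP ->; rewrite big_geq// addr0.
rewrite leq_eqVlt => /predU1P[->|aK].
  rewrite big_nat big1 ?addr0// => k /= kK.
  by rewrite leqNgt kK mul0r.
by rewrite IH// big_nat_recr//= -ltnS aK mul1r /inv_step; ring.
Qed.

(** Each symbol meets a given previous count at most once, so it meets the values [0] to [k] at most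
    [k.+1] times. *)
Lemma count_prev_le (T : finType) (x : nat -> T) (n k : nat) :
  (\sum_(1 <= t < n.+1) (Ncount x t.-1 (x t) <= k) <= #|T| * k.+1)%N.
Proof.
have -> : (\sum_(1 <= t < n.+1) (Ncount x t.-1 (x t) <= k) =
    \sum_y \sum_(0 <= j < Ncount x n y) (j <= k))%N.
  exact: (@sum_prev_count nat T x (fun j => (j <= k)%N : nat) n).
apply: (@leq_trans (\sum_(y : T) k.+1)%N); last by rewrite sum_nat_const.
apply: leq_sum => y _; elim: (Ncount x n y) => [|c IH]; first by rewrite big_geq.
rewrite big_nat_recr//=; have [ck|ck] := leqP c k; last by rewrite addn0.
rewrite addn1 ltnS (leq_trans _ ck)// -[leqRHS]muln1 -[c in leqRHS]subn0.
by rewrite -sum_nat_const_nat; apply: leq_sum => j _; exact: leq_b1.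
Qed.

(* Write both sides as layer-cake sums over [inv_step k]; at each level [k] the
   left-hand side picks at most [#|T| * k.+1] rounds, and the right-hand side
   picks the first ones, where the nonincreasing weight is largest. *)
Lemma sum_inv_prev_count_le (R : realType) (T : finType) (x : nat -> T)
    (h : nat -> R) n : (0 < #|T|)%N ->
  (forall t, (0 < t)%N -> 0 < h t) ->
  (forall t, (0 < t)%N -> h t <= h t.+1) ->
  \sum_(1 <= t < n.+1) ((Ncount x t.-1 (x t))%:R + h t)^-1 <=
  \sum_(1 <= t < n.+1) ((t.-1 %/ #|T|)%:R + h t)^-1.
Proof.
move=> T0 h0 hS.
have hmono i j : (0 < i <= j)%N -> h i <= h j.
  move=> /andP[i0 /subnK <-]; elim: (j - i)%N => [|d IH] //.
  by apply: le_trans IH _; rewrite addSn hS// addn_gt0 i0 orbT.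
have layers (a : nat -> nat) : (forall t, (0 < t <= n)%N -> (a t <= n)%N) ->
    \sum_(1 <= t < n.+1) ((a t)%:R + h t)^-1 =
    \sum_(1 <= t < n.+1) (n%:R + h t)^-1 + \sum_(0 <= k < n)
      \sum_(1 <= t < n.+1) (a t <= k)%N%:R * inv_step k (h t).
  move=> an; rewrite exchange_big/= -big_split/=; apply: eq_big_nat => t tn.
  exact/inv_layer/an.
rewrite (layers (fun t => Ncount x t.-1 (x t))); last first.
  move=> t /andP[t0 tn]; apply: leq_trans (Ncount_le _ _ _) _.
  by apply: leq_trans tn; exact: leq_pred.
rewrite (layers (fun t => t.-1 %/ #|T|)%N); last first.
  move=> t /andP[t0 tn]; apply: leq_trans (leq_div _ _) _.
  by apply: leq_trans tn; exact: leq_pred.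
rewrite lerD2l; apply: ler_sum => k _.
(* The quotient is at most [k] iff [t.-1 < #|T| * k.+1], that is, iff [t] is among the first
   [#|T| * k.+1] rounds. *)
have -> : \sum_(1 <= t < n.+1) (t.-1 %/ #|T| <= k)%N%:R * inv_step k (h t) =
    \sum_(1 <= t < n.+1) (t <= #|T| * k.+1)%N%:R * inv_step k (h t).
  apply: eq_big_nat => t /andP[t0 _].
  by rewrite -ltnS ltn_divLR// mulnC prednK.
apply: (@sum_pred_le_count _ (fun t => inv_step k (h t))
  (fun t => Ncount x t.-1 (x t) <= k)%N).
- by move=> t t0; rewrite inv_step_ge0// h0.
- move=> i j /andP[i0 ij]; apply: inv_step_le; first exact: h0.
  by apply: hmono; rewrite i0.
- exact: count_prev_le.
Qed.

(** * The finite bound (1) and nonnegativity *)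

Lemma Rmax_le (R : realType) (T : finType) (h : nat -> R) n : (0 < #|T|)%N ->
  (forall t, (1 <= t)%N -> 0 < h t) ->
  (forall t, (1 <= t)%N -> h t <= h t.+1) ->
  (Rmax T h n <=
   ((\sum_(1 <= t < n.+1) ((#|T|%:R * h t - 1) / t%:R)) +
    (\sum_(1 <= t < n.+1) (((t.-1) %/ #|T|)%:R + h t)^-1))%:E)%E.
Proof.
move=> T0 h0 hS; apply/ereal_supP => _ [x _ <-].
apply: le_trans (exp_regret_le x n h0) _; rewrite lee_fin lerD//.
  apply: ler_sum_nat => t /andP[t0 _].
  have tE : (t.-1)%:R = t%:R - 1 :> R by rewrite -subn1 natrB.
  have t1 : 0 < t%:R :> R by rewrite ltr0n.
  have mh : 0 < #|T|%:R * h t by rewrite mulr_gt0 ?ltr0n// h0.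
  apply: le_trans (@ln_ratio_le _ _ _ _ t1) _.
    by apply: ltr_wpDl.
  by rewrite tE ler_pM2r ?invr_gt0//; lra.
apply: le_trans (sum_inv_prev_count_le x n T0 h0 hS).
apply: ler_sum_nat => t /andP[t0 _].
by apply: round_bound_le_inv => //; exact: h0.
Qed.

(* A constant sequence has [L*_n = 0], and the losses are nonnegative. *)
Lemma Rmax_ge0 (R : realType) (T : finType) (h : nat -> R) n : (0 < #|T|)%N ->
  (forall t, (1 <= t)%N -> 0 < h t) -> (0 <= Rmax T h n)%E.
Proof.
move=> /card_gt0P[y _] h0; apply: le_ereal_sup_tmp.
exists (exp_regret (fun=> y) h n); first by exists (fun=> y).
rewrite /exp_regret -[leLHS](subee (x := 0%E))//; apply: leeB.
  rewrite /ExpLhat big_nat; apply: sume_ge0 => t /andP[t0 _].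
  by apply: Eu_ge0 => u u01; apply: logloss_fpf_ge0 => //; exact: h0.
apply: ereal_inf_lbound; exists (fun z => (z == y)%:R) => /=.
  split=> [z|]; first by rewrite ler0n.
  rewrite (bigD1 y)//= eqxx big1 ?addr0// => z /negPf ->//.
by rewrite big1// => t _; rewrite /logloss eqxx ltr01 ln1 oppr0.
Qed.

(** * Asymptotics: (2) and (3) *)

Lemma harmonic_sum_le (R : realType) n : (0 < n)%N ->
  \sum_(1 <= t < n.+1) t%:R^-1 <= 1 + ln n%:R :> R.
Proof.
elim: n => // n IH _; have [->|n0] := posnP n.
  by rewrite big_nat1 ln1 addr0 invr1.
rewrite big_nat_recr//=; apply: le_trans (lerD (IH n0) (lexx _)) _.
rewrite -addrA lerD2l -lerBrDl.
have p0 : 0 < n%:R :> R by rewrite ltr0n.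
have p1 : 0 < n.+1%:R :> R by rewrite ltr0n.
have := @ln_geBV _ _ (divr_gt0 p1 p0); rewrite ln_div ?posrE// invf_div.
apply: le_trans; rewrite -natr1 le_eqVlt; apply/orP; left; apply/eqP.
by field; lra.
Qed.

Lemma near_infty_ln_ge (R : realType) (A : R) : \forall n \near \oo, A <= ln (n%:R : R).
Proof.
near=> n.
have H : expR A <= n%:R by near: n; exact: nbhs_infty_ger.
by rewrite -[A]expRK ler_ln ?posrE ?expR_gt0// (lt_le_trans _ H)// expR_gt0.
Unshelve. all: by end_near. Qed.

(** With [q] the quotient and [mu = min h 1], combine [t <= (q + 1) * m] with
    [mu * (q + 1) <= q + h]. *)
Lemma inv_divn_le (R : realType) (m t : nat) (h : R) : (0 < m)%N -> (0 < t)%N ->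
  0 < h -> ((t.-1 %/ m)%:R + h)^-1 <= (m%:R / Num.min h 1) / t%:R.
Proof.
move=> m0 t0 h0; have mu0 : 0 < Num.min h 1 by rewrite lt_min h0 ltr01.
have muh : Num.min h 1 <= h by rewrite ge_min lexx.
have mu1 : Num.min h 1 <= 1 by rewrite ge_min lexx orbT.
have tq : t%:R <= ((t.-1 %/ m)%:R + 1) * m%:R :> R.
  by rewrite natr1 -natrM ler_nat -(prednK t0) ltn_ceil.
have q0 : 0 <= (t.-1 %/ m)%:R :> R by [].
have m1 : 0 < m%:R :> R by rewrite ltr0n.
have t1 : 0 < t%:R :> R by rewrite ltr0n.
move: (Num.min h 1) (t.-1 %/ m)%:R mu0 muh mu1 tq q0 => mu q mu0 muh mu1 tq q0.
rewrite -mulrA -invfM -invf_div lef_pV2 ?posrE ?divr_gt0 ?mulr_gt0//; last lra.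
rewrite ler_pdivrMr//; apply: (@le_trans _ _ (mu * ((q + 1) * m%:R))).
  by rewrite ler_pM2l.
by rewrite mulrA ler_pM2r//; nra.
Qed.

Lemma powR_div_nat (R : realType) (t : nat) (alpha : R) : (0 < t)%N ->
  t%:R `^ alpha / t%:R = (t%:R^-1) `^ (1 - alpha).
Proof.
move=> t0; have t1 : t%:R != 0 :> R by rewrite pnatr_eq0 -lt0n.
rewrite -(powR_inv1 (ler0n R t)) -powRrM mulN1r opprB powRB ?t1 ?implybT//.
by rewrite powRr1// powR_inv1.
Qed.

Lemma cvg_powR_harmonic (R : realType) (b : R) : 0 < b ->
  (fun n => (harmonic n : R) `^ b) @ \oo --> (0 : R).
Proof.
move=> b0; apply: (@cvg_comp _ _ _ (@harmonic R) (fun a => a `^ b) _ (0^'+)).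
  move=> A A0; have [e /= e0 eA] := A0.
  have H := @cvg_harmonic R _ (nbhsx_ballx (0 : R) e e0).
  near=> n; apply: eA; last exact: harmonic_gt0.
  by near: n; exact: H.
exact: powR_cvg0.
Unshelve. all: by end_near. Qed.

Lemma Rmax_powR_cvg0 (R : realType) (T : finType) (h1 alpha : R) : (0 < #|T|)%N ->
  0 < h1 -> 0 <= alpha < 1 ->
  (fun n : nat => (Rmax T (fun t => (h1 * (t%:R `^ alpha))%R) n * (n%:R^-1)%:E)%E)
    @ \oo --> 0%E.
Proof.
move=> T0 h10 /andP[a0 a1]; pose h t := h1 * (t%:R `^ alpha).
have h0 t : (1 <= t)%N -> 0 < h t by move=> t0; rewrite mulr_gt0// powR_gt0// ltr0n.
have hS t : (1 <= t)%N -> h t <= h t.+1.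
  by move=> _; rewrite ler_pM2l// ge0_ler_powR ?nnegrE// ler_nat.
pose K := #|T|%:R / Num.min h1 1.
(* [v n] bounds the summand of (1) at [t = n.+1]: the [-1] is dropped, and [h1 <= h t] lets
   [inv_divn_le] be used with the constant [h1]. *)
pose v n := #|T|%:R * h1 * (harmonic n : R) `^ (1 - alpha) + K * harmonic n.
have v0 : v @ \oo --> 0.
  have -> : 0 = #|T|%:R * h1 * 0 + K * 0 :> R by rewrite !mulr0 addr0.
  apply: cvgD; apply: cvgM; [exact: cvg_cst| |exact: cvg_cst|exact: cvg_harmonic].
  by apply: cvg_powR_harmonic; rewrite subr_gt0.
(* The shift to [n.+1] matches [arithmetic_mean v n], which averages [v 0] to [v n]. *)
have bnd : \forall n \near \oo, (0 <= Rmax T h n.+1 * (n.+1%:R^-1)%:E <=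
    (arithmetic_mean v n)%:E)%E.
  apply: nearW => n; apply/andP; split.
    by apply: mule_ge0; [exact: Rmax_ge0 | rewrite lee_fin invr_ge0].
  apply: le_trans (lee_wpmul2r _ (Rmax_le n.+1 T0 h0 hS)) _.
    by rewrite lee_fin invr_ge0.
  rewrite -EFinM lee_fin /arithmetic_mean /= mulrC ler_pM2l ?invr_gt0 ?ltr0n//.
  rewrite -big_split/= /series/= big_add1/=.
  apply: ler_sum_nat => k _; rewrite /v /=.
  have k0 : 0 < k.+1%:R^-1 :> R by rewrite invr_gt0 ltr0n.
  apply: lerD.
    rewrite -powR_div_nat// [leRHS]mulrA -[_ * h1 * _]mulrA.
    by rewrite ler_pM2r// gerBl ler01.
  apply: le_trans (inv_divn_le T0 (ltn0Sn k) h10).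
  have q0 : 0 <= (k.+1.-1 %/ #|T|)%:R :> R by [].
  have h1h : h1 <= h k.+1.
    by rewrite ler_peMr ?(ltW h10)// -[leLHS](powRr0 k.+1%:R) ler_powR// ler1n.
  by rewrite lef_pV2 ?posrE ?lerD2l// ltr_wpDl// h0.
have mean0 : (fun n => (arithmetic_mean v n)%:E) @ \oo --> 0%E.
  by apply: cvg_EFin; [exact: nearW | exact: cesaro].
rewrite -cvg_shiftS; exact: (squeeze_cvge bnd (cvg_cst 0%E) mean0).
Qed.

Lemma Rmax_cst_le_ln (R : realType) (T : finType) (h : R) : (0 < #|T|)%N -> 0 < h ->
  exists C : R, \forall n \near \oo,
    (`| Rmax T (fun _ => h) n | <= (C * ln n%:R)%R%:E)%E.
Proof.
move=> T0 h0; pose C := #|T|%:R * h + #|T|%:R / Num.min h 1.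
have C0 : 0 <= C.
  by rewrite addr_ge0 ?mulr_ge0 ?invr_ge0 ?le_min ?ler01 ?(ltW h0).
(* The factor 2 absorbs the 1 in [1 + ln n] once [ln n >= 1]. *)
exists (C * 2); near=> n.
have n0 : (0 < n)%N by near: n; exact: nbhs_infty_gt.
have l1 : 1 <= ln n%:R :> R by near: n; exact: near_infty_ln_ge.
rewrite gee0_abs; last by apply: Rmax_ge0.
apply: le_trans (Rmax_le n T0 (fun _ _ => h0) (fun _ _ => lexx h)) _.
rewrite lee_fin -big_split/=.
apply: (@le_trans _ _ (\sum_(1 <= t < n.+1) C * t%:R^-1)).
  apply: ler_sum_nat => t /andP[t0 _]; rewrite /C [leRHS]mulrDl; apply: lerD.
    by apply: ler_wpM2r; [rewrite invr_ge0|lra].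
  exact: inv_divn_le.
rewrite -mulr_sumr -mulrA ler_wpM2l//.
by apply: le_trans (harmonic_sum_le R n0) _; lra.
Unshelve. all: by end_near. Qed.

(** Starts from [exp_regret_le], because [Rmax_le] no longer holds the refined [round_bound];
    regrouping by symbol gives [#|T|] sums of at most [n] terms. *)
Lemma Rmax_inv_card_le_ln (R : realType) (T : finType) : (0 < #|T|)%N ->
  \forall n \near \oo,
    (Rmax T (fun _ => (#|T|%:R^-1 : R)%R) n <= (#|T|%:R * ln (n%:R : R))%R%:E)%E.
Proof.
move=> T0; pose m : R := #|T|%:R; pose h : R := m^-1.
have m1 : 1 <= m by rewrite ler1n.
have h0 : 0 < h by rewrite invr_gt0; lra.
have h1 : h <= 1 by rewrite invf_le1; lra.
have mh : m * h = 1 by rewrite mulfV// gt_eqF//; lra.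
near=> n.
have n0 : (0 < n)%N by near: n; exact: nbhs_infty_gt.
(* The final total is [m * m + m * (1 + ln n) - (1 + ln n) / 4]; it is at most [m * ln n] once
   [m * m + m <= (1 + ln n) / 4]. *)
have ln_large : 4 * (m * m + m) <= ln n%:R :> R by near: n; exact: near_infty_ln_ge.
apply/ereal_supP => _ [x _ <-].
apply: le_trans (exp_regret_le x n (fun _ _ => h0)) _; rewrite lee_fin.
(* As [m * h = 1], every term [ln (t - 1 + m * h) - ln t] vanishes. *)
rewrite big_nat big1 ?add0r; last first.
  move=> t /andP[t0 _]; rewrite mh.
  by rewrite natr1 prednK// subrr.
rewrite (sum_prev_count x (fun k => round_bound k%:R h)).
(* The term [k = 0] is [round_bound 0 h = h^-1 = m]; the terms [k >= 1] form a harmonic sum with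
   coefficient [1 - h / 4]. *)
have inner y : \sum_(0 <= k < Ncount x n y) round_bound k%:R h <=
    m + (1 - h / 4) * (1 + ln n%:R).
  have H : \sum_(1 <= k < n.+1) (1 - h / 4) / k%:R <= (1 - h / 4) * (1 + ln n%:R).
    by rewrite -mulr_sumr ler_wpM2l ?harmonic_sum_le//; lra.
  have cn := Ncount_le x n y; move: (Ncount x n y) cn => c cn.
  have term0 k : 0 <= (1 - h / 4) / k%:R by rewrite divr_ge0//; lra.
  have [->|c0] := posnP c.
    rewrite big_geq//; apply: addr_ge0; first lra.
    by apply: le_trans H; apply: sumr_ge0.
  rewrite big_ltn// round_bound0// invrK; apply: lerD => //.
  apply: le_trans H; rewrite [leRHS](big_cat_nat (n := c))//= ?(leqW cn)//.
  rewrite -[leLHS]addr0; apply: lerD; last exact: sumr_ge0.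
  apply: ler_sum_nat => k /andP[k0 _].
  by apply: round_bound_le_invl; rewrite ?ltr0n// h0.
apply: (@le_trans _ _ (\sum_(y : T) (m + (1 - h / 4) * (1 + ln n%:R)))).
  by apply: ler_sum => y _; exact: inner.
have -> : \sum_(y : T) (m + (1 - h / 4) * (1 + ln n%:R)) =
    m * m + m * (1 + ln n%:R) - (m * h) / 4 * (1 + ln n%:R).
  by rewrite sumr_const -mulr_natl -/m; ring.
by rewrite mh; lra.
Unshelve. all: by end_near. Qed.

Theorem theorem3 (R : realType) (T : finType) : (0 < #|T|)%N ->
  (forall h : nat -> R,
     (forall t, (1 <= t)%N -> 0 < h t) ->
     (forall t, (1 <= t)%N -> h t <= h t.+1) ->
     forall n : nat,
       (Rmax T h n <=
        ((\sum_(1 <= t < n.+1) ((#|T|%:R * h t - 1) / t%:R)) +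
         (\sum_(1 <= t < n.+1) (((t.-1) %/ #|T|)%:R + h t)^-1))%:E)%E)
  /\
  (forall h1 alpha : R, 0 < h1 -> 0 <= alpha < 1 ->
     (fun n : nat => (Rmax T (fun t => (h1 * (t%:R `^ alpha))%R) n * (n%:R^-1)%:E)%E)
       @ \oo --> 0%E)
  /\
  (forall h : R, 0 < h ->
     exists C : R, \forall n \near \oo,
       (`| Rmax T (fun _ => h) n | <= (C * ln n%:R)%R%:E)%E)
  /\
  (\forall n \near \oo,
     (Rmax T (fun _ => (#|T|%:R^-1 : R)%R) n <= (#|T|%:R * ln (n%:R : R))%R%:E)%E).
Proof.
move=> T0; split; first by move=> h h0 hS n; exact: Rmax_le.
split; first by move=> h1 alpha h10 a01; exact: Rmax_powR_cvg0.
split; first by move=> h h0; exact: Rmax_cst_le_ln.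
exact: Rmax_inv_card_le_ln.
Qed.
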